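(* Consider a purely resistively coupled network of $q\ge 2$ identical LC oscillators on $n$ nodes, described by $$AA^{T}(\ddot e+\omega_0^2 e)+G\dot e=0,\qquad v=A^{T}e,$$ where $\omega_0>0$, $A\in\mathbb{R}^{n\times q}$ is the oriented incidence matrix of the oscillators and $G\in\mathbb{R}^{n\times n}$ is the Laplacian matrix of the resistive couplers. This network is synchronous if and only if its linkage $(\mathcal{V},\mathcal{E}_{\rm o},\mathcal{E}_{\rm c})$ is bilayer and both its layers are connected.
   Context: Network. $\mathcal{V}=\{\nu_1,\dots,\nu_n\}$ is the set of nodes, $e(t)=[e_1\ \cdots\ e_n]^T\in\mathbb{R}^n$ is the vector of node voltages, $v(t)=[v_1\ \cdots\ v_q]^T\in\mathbb{R}^q$ is the vector of oscillator voltages, and $q\ge2$. Each oscillator $k$ extends between two distinct nodes $\nu_r$ (positive terminal) and $\nu_s$ (negative terminal), and the $k$th column of $A$ is $I(:,r)-I(:,s)$, where $I(:,r)$ is the $r$th column of the $n\times n$ identity matrix; thus $v_k=e_r-e_s$. At most one oscillator extends between any pair of nodes (so no two columns of $A$ are equal up to sign), and each node is incident to at least one oscillator (so $A$ has no zero row). For $r\neq s$, $g_{rs}=g_{sr}\ge 0$ is the conductance of the resistor between $\nu_r$ and $\nu_s$ ($g_{rs}=0$ means no resistor). $G$ is the weighted Laplacian with off-diagonal entries $-g_{rs}$ and diagonal entries $\sum_{s\ne r}g_{rs}$. Synchrony. The network is (nontrivially) synchronous if $|v_k(t)|-|v_\ell(t)|\to0$ as $t\to\infty$ for all pairs $(k,\ell)$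 and all initial conditions (i.e. along every solution), and $v_k(t)\not\to0$ for some $k$ and some initial conditions (i.e. along some solution). Linkage. $\mathcal{E}_{\rm o}$ is the set of the $q$ unordered pairs $\{\nu_r,\nu_s\}$ between which there is an oscillator; $\mathcal{E}_{\rm c}$ is the set of unordered pairs $\{\nu_r,\nu_s\}$, $r\ne s$, with $g_{rs}>0$. The triple $(\mathcal{V},\mathcal{E}_{\rm o},\mathcal{E}_{\rm c})$ is the linkage of the network. Bilayer and layers. A bipartition of a graph $(\mathcal{V},\mathcal{E})$ is a pair of disjoint sets $(\mathcal{V}_1,\mathcal{V}_2)$ with $\mathcal{V}_1\cup\mathcal{V}_2=\mathcal{V}$ such that each edge in $\mathcal{E}$ has one endpoint in $\mathcal{V}_1$ and the other in $\mathcal{V}_2$. The linkage is bilayer if the graph $(\mathcal{V},\mathcal{E}_{\rm o})$ has a bipartition $(\mathcal{V}_1,\mathcal{V}_2)$ such that no edge in $\mathcal{E}_{\rm c}$ extends between $\mathcal{V}_1$ and $\mathcal{V}_2$. In that case the layers (associated with this bipartition) are the two disjoint subgraphs $(\mathcal{V}_1,\mathcal{E}_1)$, $(\mathcal{V}_2,\mathcal{E}_2)$ with $(\mathcal{V}_1,\mathcal{E}_1)\cup(\mathcal{V}_2,\mathcal{E}_2)=(\mathcal{V},\mathcal{E}_{\rm c})$, i.e. $\mathcal{E}_i$ consists of the edges of $\mathcal{E}_{\rm c}$ with both endpoints in $\mathcal{V}_i$. ''Bilayer and both its layers are connected'' means that there is such a bipartition for which both layers are connected graphs. *)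

(* Defs.v *)
From HB Require Import structures.
From mathcomp Require Import all_boot all_order all_algebra.

Set Implicit Arguments.
Unset Strict Implicit.
Unset Printing Implicit Defensive.

(* A graph (V, E) is a vertex set together with a set of unordered pairs
   [set x; y] of vertices. *)
Section Graphs.
Variable T : finType.
Implicit Types (V : {set T}) (E : {set {set T}}).

Definition edge_between V1 V2 (d : {set T}) : Prop :=
  exists x y, [/\ x \in V1, y \in V2 & d = [set x; y]].

Definition bipartition V E V1 V2 : Prop :=
  [/\ [disjoint V1 & V2], V1 :|: V2 = V
    & forall d, d \in E -> edge_between V1 V2 d].

(* The empty graph counts as connected. It never occurs as a layer of a network
   having an oscillator, since each oscillator has a terminal in both layers. *)
Definition connected_graph V E : Prop :=
  {in V &, forall x y, connect [rel a b | [set a; b] \in E] x y}.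

End Graphs.

Record linkage (T : finType) := Linkage {
  nodes : {set T};
  osc_edges : {set {set T}};
  coupler_edges : {set {set T}}
}.

Section Linkage.
Variables (T : finType) (L : linkage T).

Definition bilayer_partition (V1 V2 : {set T}) : Prop :=
  bipartition (nodes L) (osc_edges L) V1 V2 /\
  (forall d, d \in coupler_edges L -> ~ edge_between V1 V2 d).

Definition layer_edges (Vi : {set T}) : {set {set T}} :=
  [set d in coupler_edges L | d \subset Vi].

Definition bilayer_with_connected_layers : Prop :=
  exists V1 V2 : {set T},
    [/\ bilayer_partition V1 V2,
        connected_graph V1 (layer_edges V1)
      & connected_graph V2 (layer_edges V2)].

End Linkage.

From mathcomp Require Import all_classical all_reals all_analysis.

Import Order.TTheory GRing.Theory Num.Theory numFieldNormedType.Exports.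

Local Open Scope classical_set_scope.
Local Open Scope ring_scope.

(* A resistively coupled LC oscillator network on the nodes 'I_n: oscillator k
   extends from its positive terminal [osc_pos k] to its negative terminal
   [osc_neg k]; [conductance r s] is g_{rs} for r != s, and its diagonal values
   are irrelevant. *)
Record network (R : realType) (n q : nat) := Network {
  osc_pos : 'I_q -> 'I_n;
  osc_neg : 'I_q -> 'I_n;
  conductance : 'I_n -> 'I_n -> R;
  osc_terminals_neq : forall k, osc_pos k != osc_neg k;
  osc_simple : injective (fun k => [set osc_pos k; osc_neg k]%SET);
  osc_cover : forall r, exists k, r \in [set osc_pos k; osc_neg k]%SET;
  conductance_sym : forall r s, r != s -> conductance r s = conductance s r;
  conductance_ge0 : forall r s, r != s -> 0 <= conductance r s
}.

Section Dynamics.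
Variables (R : realType) (n q : nat) (N : network R n q).

Definition incidence : 'M[R]_(n, q) :=
  \matrix_(i < n, k < q) ((i == osc_pos N k)%:R - (i == osc_neg N k)%:R).

Definition laplacian : 'M[R]_n :=
  \matrix_(i < n, j < n)
    (if i == j then \sum_(s < n | s != i) conductance N i s
     else - conductance N i j).

(* A solution is a twice differentiable trajectory satisfying the equation for
   all t >= 0. At t = 0 the derivatives are two-sided; this loses nothing, since
   a trajectory on [0, +oo[ that is twice differentiable (one-sidedly at 0)
   extends to negative times by its second-order Taylor polynomial at 0. *)
Definition is_solution (omega0 : R) (e : R -> 'cV[R]_n) : Prop :=
  forall t : R, 0 <= t ->
    [/\ derivable e t 1,
        derivable (derive1 e) t 1
      & incidence *m incidence^T *m (derive1 (derive1 e) t + omega0 ^+ 2 *: e t)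
          + laplacian *m derive1 e t = 0].

Definition osc_voltage (e : R -> 'cV[R]_n) (t : R) : 'cV[R]_q :=
  incidence^T *m e t.

Definition synchronous (omega0 : R) : Prop :=
  (forall e, is_solution omega0 e -> forall k l : 'I_q,
     `|osc_voltage e t k 0| - `|osc_voltage e t l 0| @[t --> +oo] --> (0 : R))
  /\ (exists2 e, is_solution omega0 e &
      exists k : 'I_q, ~ (osc_voltage e t k 0 @[t --> +oo] --> (0 : R))).

End Dynamics.

Definition network_linkage (R : realType) (n q : nat) (N : network R n q) :
    linkage 'I_n :=
  {| nodes := [set: 'I_n]%SET;
     osc_edges := [set [set osc_pos N k; osc_neg N k] | k : 'I_q]%SET;
     coupler_edges :=
       [set [set p.1; p.2] | p : 'I_n * 'I_n
          & (p.1 != p.2) && (0 < conductance N p.1 p.2)%R]%SET |}.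

(* Main.v *)
Require Import Defs.
From mathcomp Require Import all_boot all_order all_algebra.
From mathcomp Require Import all_classical all_reals all_analysis.
From mathcomp Require Import ring lra.

Set Implicit Arguments.
Unset Strict Implicit.
Unset Printing Implicit Defensive.

Import Order.TTheory GRing.Theory Num.Theory numFieldNormedType.Exports.

Local Open Scope classical_set_scope.
Local Open Scope ring_scope.

(* If [V1], [V2] are connected layers with indicator [x] of [V1], then
   [cos (omega0 t) x] is a solution as [G x = 0], with voltages
   [+- cos (omega0 t)]. Every solution is [y(t) x] plus a solution [w] whose
   voltages are orthogonal to those of [x]. On that complement [G] dominates
   [A A^T], so the energy of [w] is dissipated and its voltages vanish.
   Conversely, if every oscillator had both ends in one component of the coupler
   graph, [G] would dominate [A A^T] everywhere and all voltages would vanish; so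
   some oscillator joins two distinct components [C1], [C2]. The indicators of
   [C1] and [C2] lie in [ker G], and synchrony along their cosine solutions
   forces every oscillator to have exactly one end in each [Ci]; as every node
   is a terminal, [C1] and [C2] are the layers. *)

(** * Euclidean inner product of column vectors *)

Section Dot.
Variable R : realType.

Definition dot m (u v : 'cV[R]_m) : R := (u^T *m v) 0 0.

Lemma dotE m (u v : 'cV[R]_m) : dot u v = \sum_i u i 0 * v i 0.
Proof. by rewrite /dot mxE; apply: eq_bigr => i _; rewrite mxE. Qed.

Lemma dotC m (u v : 'cV[R]_m) : dot u v = dot v u.
Proof. by rewrite !dotE; apply: eq_bigr => i _; rewrite mulrC. Qed.

Lemma dotDl m (u1 u2 v : 'cV[R]_m) : dot (u1 + u2) v = dot u1 v + dot u2 v.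
Proof. by rewrite /dot linearD mulmxDl mxE. Qed.

Lemma dotZl m a (u v : 'cV[R]_m) : dot (a *: u) v = a * dot u v.
Proof. by rewrite /dot linearZ -scalemxAl mxE. Qed.

Lemma dot0l m (v : 'cV[R]_m) : dot 0 v = 0.
Proof. by rewrite /dot trmx0 mul0mx mxE. Qed.

Lemma dot_mulmxl m p (M : 'M[R]_(p, m)) u v : dot (M *m u) v = dot u (M^T *m v).
Proof. by rewrite /dot trmx_mul mulmxA. Qed.

Lemma dot_ge0 m (u : 'cV[R]_m) : 0 <= dot u u.
Proof. by rewrite dotE sumr_ge0// => i _; rewrite -expr2 sqr_ge0. Qed.

Lemma dot_sqrD m (u v : 'cV[R]_m) c :
  dot (u + c *: v) (u + c *: v) = dot u u + 2 * c * dot u v + c ^+ 2 * dot v v.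
Proof.
rewrite dotDl ![dot _ (u + _)]dotC !dotDl !dotZl ![dot _ (_ *: v)]dotC !dotZl.
by rewrite (dotC v u); ring.
Qed.

Lemma sqr_coord_le_dot m (u : 'cV[R]_m) i : u i 0 ^+ 2 <= dot u u.
Proof.
rewrite dotE (bigD1 i)//= -expr2 lerDl sumr_ge0// => j _.
by rewrite -expr2 sqr_ge0.
Qed.

End Dot.

(** * Derivatives of vector trajectories and limits at infinity *)

Section Derivatives.
Variable R : realType.

Lemma is_derive_cVP m (f : R -> 'cV[R]_m) (t : R) (d : 'cV[R]_m) :
  is_derive t 1 f d <-> forall i, is_derive t 1 (fun s => f s i 0) (d i 0).
Proof.
split=> [[fd <-] i|fd].
  have /derivable_mxP fi := fd.
  by apply: DeriveDef => //; rewrite derive_mx// mxE.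
have fd' : derivable f t 1.
  by apply/derivable_mxP => i j; rewrite ord1; have [] := fd i.
apply: DeriveDef => //; apply/matrixP => i j.
by rewrite derive_mx// mxE !ord1; have [_ ->] := fd i.
Qed.

Lemma is_derive_mulmx m p (M : 'M[R]_(p, m)) (f : R -> 'cV[R]_m) (t : R)
    (d : 'cV[R]_m) :
  is_derive t 1 f d -> is_derive t 1 (fun s => M *m f s) (M *m d).
Proof.
move=> /is_derive_cVP fd; apply/is_derive_cVP => i; rewrite mxE.
rewrite (_ : (fun s => _) = \sum_j (M i j \*: (fun s => f s j 0))).
  by apply: is_derive_sum => j; apply: is_deriveZ.
by apply/funext => s; rewrite mxE fct_sumE.
Qed.

Lemma is_derive_dot m (f g : R -> 'cV[R]_m) (t : R) df dg :
  is_derive t 1 f df -> is_derive t 1 g dg ->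
  is_derive t 1 (fun s => dot (f s) (g s)) (dot df (g t) + dot (f t) dg).
Proof.
move=> /is_derive_cVP fd /is_derive_cVP gd.
rewrite (_ : (fun s => _) = \sum_j ((fun s => f s j 0) * (fun s => g s j 0))).
  rewrite (_ : _ + _ = \sum_j (f t j 0 *: dg j 0 + g t j 0 *: df j 0)).
    by apply: is_derive_sum => j; apply: is_deriveM.
  rewrite !dotE -big_split/=; apply: eq_bigr => j _.
  by rewrite addrC [df j 0 * _]mulrC.
by apply/funext => s; rewrite dotE fct_sumE.
Qed.

Lemma nonincreasing_of_deriv_le0 (f df : R -> R) :
  (forall t : R, 0 <= t -> is_derive t 1 f (df t)) ->
  (forall t, 0 <= t -> df t <= 0) -> forall t, 0 <= t -> f t <= f 0.
Proof.
move=> fd df0 t t0; apply: (@ler0_derive1_nincry _ f 0) => //.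
- by move=> x; rewrite in_itv/= andbT => /ltW x0; have [] := fd _ x0.
- move=> x; rewrite in_itv/= andbT => /ltW x0; rewrite derive1E.
  by have [_ ->] := fd _ x0; apply: df0.
- apply: derivable_within_continuous => x; rewrite in_itv/= andbT => x0.
  by have [] := fd _ x0.
Qed.

(** As soon as [t * e ^+ 2] exceeds [K], the bound excludes [|f t| >= e]. *)
Lemma cvg0_of_sqr_le (f : R -> R) (K : R) :
  (forall t, 0 <= t -> t * f t ^+ 2 <= K) -> f t @[t --> +oo] --> (0 : R).
Proof.
move=> fK; apply/cvgr0Pnorm_lt => e e0; near=> t.
have t0 : 0 < t by near: t; apply: nbhs_pinfty_gt.
have tK : K < t * e ^+ 2.
  rewrite -ltr_pdivrMr ?exprn_gt0//.
  by near: t; apply: nbhs_pinfty_gt; rewrite num_real.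
rewrite ltNge; apply/negP => ef.
have : t * e ^+ 2 <= t * f t ^+ 2.
  by rewrite ler_pM2l// -(real_normK (num_real (f t))) lerXn2r ?nnegrE// ltW.
by move: (fK _ (ltW t0)) => ? ?; lra.
Unshelve. all: by end_near. Qed.

Lemma cos_frequently1 (omega M : R) : 0 < omega ->
  exists2 t, M <= t & cos (omega * t) = 1.
Proof.
move=> o0; have p0 : 0 < pi *+ 2 :> R by rewrite mulrn_wgt0// pi_gt0.
have [k kM] : exists k : nat, M * omega / (pi *+ 2) <= k%:R.
  exists (Num.bound `|M * omega / (pi *+ 2)|).
  exact: le_trans (ler_norm _) (ltW (archi_boundP (normr_ge0 _))).
(* The end of the [k]th period, with [k] taken large enough by the archimedean property. *)
exists (pi *+ 2 *+ k / omega).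
  by move: kM; rewrite ler_pdivlMr// ler_pdivrMr// mulr_natl.
rewrite mulrCA divff ?gt_eqF// mulr1 -[X in cos X]add0r.
by rewrite (periodicn (@cosD2pi R)) cos0.
Qed.

(** Serves to read off constraints on a kernel vector [x] of [G] from the behaviour of
    [cos (omega0 t) x], which returns to [x] at arbitrarily late times. *)
Lemma cvg0_frequently_eq (f : R -> R) (c : R) :
  (forall M, exists2 t, M <= t & f t = c) ->
  f t @[t --> +oo] --> (0 : R) -> c = 0.
Proof.
move=> fc /cvgr0Pnorm_lt f0; apply/eqP; apply: contraT; rewrite -normr_gt0 => c0.
have [M [_ Mf]] := f0 _ c0.
have [t Mt ft] := fc (M + 1).
have Mlt : M < t by rewrite (lt_le_trans _ Mt)// ltrDl.
by have := Mf t Mlt; rewrite /= ft ltxx.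
Qed.

End Derivatives.

(** * Oscillator voltages and the quadratic form of the Laplacian *)

Section Network.
Variables (R : realType) (n q : nat) (N : network R n q).
Local Notation A := (incidence N).
Local Notation G := (laplacian N).
Local Notation g := (conductance N).

Lemma voltageE (x : 'cV[R]_n) k :
  (A^T *m x) k 0 = x (osc_pos N k) 0 - x (osc_neg N k) 0.
Proof.
rewrite mxE; under eq_bigr => i _ do rewrite !mxE mulrBl.
rewrite sumrB; congr (_ - _).
  rewrite (bigD1 (osc_pos N k))//= eqxx mul1r big1 ?addr0// => i /negbTE ->.
  by rewrite mul0r.
rewrite (bigD1 (osc_neg N k))//= eqxx mul1r big1 ?addr0// => i /negbTE ->.
by rewrite mul0r.
Qed.

Lemma laplacian_mulE (x : 'cV[R]_n) i :
  (G *m x) i 0 = \sum_(j | j != i) g i j * (x i 0 - x j 0).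
Proof.
rewrite mxE (bigD1 i)//= mxE eqxx mulr_suml.
under [X in _ + X]eq_bigr => j ji do rewrite mxE eq_sym (negbTE ji) mulNr.
rewrite sumrN -sumrB; apply: eq_bigr => j _; by rewrite mulrBr.
Qed.

Lemma trmx_laplacian : G^T = G.
Proof.
apply/matrixP => i j; rewrite !mxE eq_sym; case: eqVneq => [->//|ij].
by rewrite conductance_sym// eq_sym.
Qed.

Lemma dot_laplacianC (x y : 'cV[R]_n) : dot (G *m x) y = dot (G *m y) x.
Proof. by rewrite dot_mulmxl trmx_laplacian dotC. Qed.

(** The double sum runs over ordered pairs, so each resistor is counted twice. Adding to the plain
    expansion its copy with exchanged indices completes the squares, by symmetry of the
    conductances. *)
Lemma dot_laplacianE (x : 'cV[R]_n) :
  2 * dot (G *m x) x =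
  \sum_i \sum_(j | j != i) g i j * (x i 0 - x j 0) ^+ 2.
Proof.
have GE : dot (G *m x) x =
    \sum_i \sum_(j | j != i) g i j * (x i 0 - x j 0) * x i 0.
  by rewrite dotE; apply: eq_bigr => i _; rewrite laplacian_mulE mulr_suml.
rewrite mulr_natl mulr2n {2}GE (exchange_big_dep xpredT)//= GE -big_split/=.
apply: eq_bigr => i _.
rewrite [X in _ + X](eq_bigl (fun j => j != i)); last by move=> j; rewrite eq_sym.
rewrite -big_split/=; apply: eq_bigr => j ji.
by rewrite (conductance_sym N ji); ring.
Qed.

Lemma laplacian_term_ge0 (x : 'cV[R]_n) i j :
  j != i -> 0 <= g i j * (x i 0 - x j 0) ^+ 2.
Proof. by move=> ji; rewrite mulr_ge0 ?sqr_ge0// conductance_ge0// eq_sym. Qed.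

Lemma dot_laplacian_ge0 (x : 'cV[R]_n) : 0 <= dot (G *m x) x.
Proof.
rewrite -(pmulr_rge0 _ (ltr0n R 2)) dot_laplacianE.
by apply: sumr_ge0 => i _; apply: sumr_ge0 => j; apply: laplacian_term_ge0.
Qed.

Lemma edge_le_dot_laplacian (x : 'cV[R]_n) i j : j != i ->
  g i j * (x i 0 - x j 0) ^+ 2 <= 2 * dot (G *m x) x.
Proof.
move=> ji; rewrite dot_laplacianE (bigD1 i)//= (bigD1 j)//= -addrA lerDl.
rewrite addr_ge0//; apply: sumr_ge0 => k.
  by move=> /andP[ki _]; apply: laplacian_term_ge0.
by move=> _; apply: sumr_ge0 => l; apply: laplacian_term_ge0.
Qed.

(** * Energy dissipation along solutions *)

Section Trajectories.
Variables (omega0 : R) (omega0_gt0 : 0 < omega0).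

(** Carrying the derivatives as explicit functions lets a linear map be applied to a solution
    without recomputing [derive1]. *)
Definition trajectory (e e1 e2 : R -> 'cV[R]_n) : Prop :=
  forall t : R, 0 <= t ->
    [/\ is_derive t 1 e (e1 t), is_derive t 1 e1 (e2 t)
      & A *m A^T *m (e2 t + omega0 ^+ 2 *: e t) + G *m e1 t = 0].

Lemma solution_trajectory e : is_solution N omega0 e ->
  trajectory e (derive1 e) (derive1 (derive1 e)).
Proof.
move=> se t t0; have [de dde eq] := se t t0.
by split; first exact: (DeriveDef de (esym (derive1E _ _)));
  first exact: (DeriveDef dde (esym (derive1E _ _))).
Qed.

(** The first derivative is required at negative times too, because differentiating [derive1 e] at
    [0] looks at both sides of [0]. *)
Lemma trajectory_solution e e1 e2 :
  (forall t : R, is_derive t 1 e (e1 t)) -> trajectory e e1 e2 ->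
  is_solution N omega0 e.
Proof.
move=> de te; have e1E : derive1 e = e1.
  by apply/funext => t; rewrite derive1E; have [_ ->] := de t.
move=> t t0; have [det de1 eq] := te t t0; rewrite e1E.
split; [by have [] := det|by have [] := de1|].
by rewrite derive1E; have [_ ->] := de1.
Qed.

(** Weak form of the equation; it eliminates [e2] from the derivatives of quadratic quantities. *)
Lemma dot_trajectory e e1 e2 (y : 'cV[R]_n) t : trajectory e e1 e2 -> 0 <= t ->
  dot (A^T *m e2 t) (A^T *m y) =
  - omega0 ^+ 2 * dot (A^T *m e t) (A^T *m y) - dot (G *m e1 t) y.
Proof.
move=> te t0; have [_ _ /(congr1 (fun x => dot x y))] := te t t0.
rewrite dot0l dotDl -mulmxA dot_mulmxl mulmxDr -scalemxAr dotDl dotZl.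
by move=> /eqP; rewrite addr_eq0 => /eqP eq; rewrite mulNr -eq; ring.
Qed.

(* The energy [E] is nonincreasing; adding a small multiple [d] of a cross term
   gives [F >= 0] with [F' <= - d E], so that [F + d t E] is nonincreasing and
   [E] decays like [1 / t]. *)
Lemma voltage_cvg0 e e1 e2 C : 0 <= C -> trajectory e e1 e2 ->
  (forall t, 0 <= t ->
     dot (A^T *m e1 t) (A^T *m e1 t) <= C * dot (G *m e1 t) (e1 t)) ->
  forall k, (A^T *m e t) k 0 @[t --> +oo] --> (0 : R).
Proof.
move=> C0 te dissip k.
(* Dissipation will give [c * a t <= r t]; the [+ 1] keeps [c] defined when [C = 0]. *)
pose c := (C + 1)^-1.
have C1 : 0 < C + 1 by rewrite ltr_pwDr.
have c0 : 0 < c by rewrite invr_gt0.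
pose a t := dot (A^T *m e1 t) (A^T *m e1 t).
pose b t := dot (A^T *m e t) (A^T *m e t).
pose m t := dot (A^T *m e1 t) (A^T *m e t).
pose p t := dot (G *m e t) (e t).
pose r t := dot (G *m e1 t) (e1 t).
pose s t := dot (G *m e1 t) (e t).
pose w2 := omega0 ^+ 2.
pose E t := 2^-1 * (a t + w2 * b t).
(* The bound [c / 2] lets the dissipation absorb all terms in [a]; the bound [omega0] keeps [F]
   nonnegative. *)
pose d := Num.min (c / 2) omega0.
have d0 : 0 < d by rewrite lt_min divr_gt0.
have dc : d <= c / 2 by rewrite ge_min lexx.
have dw : d <= omega0 by rewrite ge_min lexx orbT.
have w20 : 0 < w2 by rewrite exprn_gt0.
have a0 t : 0 <= a t by apply: dot_ge0.
have b0 t : 0 <= b t by apply: dot_ge0.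
have p0 t : 0 <= p t by apply: dot_laplacian_ge0.
have r0 t : 0 <= r t by apply: dot_laplacian_ge0.
(* The derivative [s] of [2^-1 * p] cancels the [- s] in the derivative of [m]. *)
pose F t := E t + d * (m t + 2^-1 * p t).
have F0 t : 0 <= F t.
  (* This square bounds the cross term [m] from below by the energy. *)
  have := dot_ge0 (A^T *m e1 t + omega0 *: (A^T *m e t)).
  rewrite dot_sqrD => h.
  have dh : 0 <= d * (a t + 2 * omega0 * m t + w2 * b t).
    by rewrite mulr_ge0// ltW.
  have wd : 0 <= (omega0 - d) * (a t + w2 * b t).
    by rewrite mulr_ge0 ?subr_ge0// addr_ge0// mulr_ge0// ltW.
  have dp : 0 <= omega0 * (d * p t) by rewrite !mulr_ge0// ltW.
  by rewrite -(pmulr_rge0 _ omega0_gt0) /F /E; lra.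
have ad (t : R) : 0 <= t -> is_derive t 1 a (- 2 * (w2 * m t + r t)).
  move=> t0; have [_ de1 _] := te t t0.
  have dAe1 := is_derive_mulmx A^T de1.
  apply: (is_derive_eq (is_derive_dot dAe1 dAe1)).
  rewrite [X in _ + X]dotC (dot_trajectory _ te t0) dotC -/(m t) -/(r t) -/w2.
  ring.
have bd (t : R) : 0 <= t -> is_derive t 1 b (2 * m t).
  move=> t0; have [de _ _] := te t t0.
  have dAe := is_derive_mulmx A^T de.
  apply: (is_derive_eq (is_derive_dot dAe dAe)).
  by rewrite [X in _ + X]dotC -/(m t); ring.
have md (t : R) : 0 <= t -> is_derive t 1 m (a t - w2 * b t - s t).
  move=> t0; have [de de1 _] := te t t0.
  have dAe := is_derive_mulmx A^T de.
  have dAe1 := is_derive_mulmx A^T de1.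
  apply: (is_derive_eq (is_derive_dot dAe1 dAe)).
  by rewrite (dot_trajectory _ te t0) -/(a t) -/(b t) -/(s t) -/w2; ring.
have pd (t : R) : 0 <= t -> is_derive t 1 p (2 * s t).
  move=> t0; have [de _ _] := te t t0.
  apply: (is_derive_eq (is_derive_dot (is_derive_mulmx G de) de)).
  by rewrite dot_laplacianC -/(s t) [dot (G *m e t) _]dot_laplacianC -/(s t); ring.
have Ed (t : R) : 0 <= t -> is_derive t 1 E (- r t).
  move=> t0.
  apply: (is_derive_eq
    (is_deriveZ 2^-1 (is_deriveD (ad t t0) (is_deriveZ w2 (bd t t0))))).
  by rewrite /GRing.scale/=; field.
have Fd (t : R) : 0 <= t -> is_derive t 1 F (- r t + d * (a t - w2 * b t)).
  move=> t0.
  apply: (is_derive_eq (is_deriveD (Ed t t0)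
    (is_deriveZ d (is_deriveD (md t t0) (is_deriveZ 2^-1 (pd t t0)))))).
  by rewrite /GRing.scale/=; field.
pose H t := F t + d * (t * E t).
have Hd (t : R) : 0 <= t -> is_derive t 1 H
    (- r t + d * (a t - w2 * b t) + d * (E t - t * r t)).
  move=> t0.
  apply: (is_derive_eq (is_deriveD (Fd t t0)
    (is_deriveZ d (is_deriveM (is_derive_id t 1) (Ed t t0))))).
  by rewrite /GRing.scale/=; ring.
have HF t : 0 <= t -> H t <= F 0.
  move=> t0; rewrite (_ : F 0 = H 0); last by rewrite /H mul0r mulr0 addr0.
  apply: (nonincreasing_of_deriv_le0 Hd) => // {t0}t t0.
  have tr : 0 <= d * (t * r t) by rewrite !mulr_ge0// ltW.
  have db : 0 <= d * (w2 * b t) by rewrite !mulr_ge0// ltW.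
  have da : 2 * (d * a t) <= c * a t.
    by rewrite mulrA ler_wpM2r//; move: dc; lra.
  have cr : c * a t <= r t.
    rewrite ler_pdivrMl// (le_trans (dissip t t0))// ler_wpM2r ?lerDl//.
    exact: r0.
  by move: (r0 t); rewrite /E; lra.
(* From [H t <= F 0] and [0 <= F t] follows [d * (t * E t) <= F 0], and [E t] is at least
   [2^-1 * w2 * b t]. *)
apply: (@cvg0_of_sqr_le _ _ (2 * F 0 / (d * w2))) => t t0.
have vb : t * (A^T *m e t) k 0 ^+ 2 <= t * b t.
  by rewrite ler_wpM2l//; apply: sqr_coord_le_dot.
apply: (le_trans vb); rewrite ler_pdivlMr ?mulr_gt0//.
have ta : 0 <= d * (t * a t) by rewrite !mulr_ge0// ltW.
by move: (HF t t0) (F0 t); rewrite /H /E; lra.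
Qed.

End Trajectories.
End Network.

(** * Connected components of the coupler graph *)

Section Graphs.
Variable T : finType.
Implicit Types (V : {set T}) (E : {set {set T}}).

Definition adjacent E : rel T := [rel a b | [set a; b]%SET \in E].

Lemma connect_adjacentC E : connect_sym (adjacent E).
Proof.
by apply: sym_connect_sym => a b; rewrite /adjacent/= finset.setUC.
Qed.

(** A path that starts in the component of [i] never leaves it, so all its edges belong to the
    layer. *)
Lemma component_layer_connected (L : linkage T) i :
  let V := [set j | connect (adjacent (coupler_edges L)) i j]%SET in
  connected_graph V (layer_edges L V).
Proof.
move=> V x y; rewrite !inE => ix iy.
have /connectP[p] : connect (adjacent (coupler_edges L)) x y.
  by apply: connect_trans iy; rewrite connect_adjacentC.
elim: p x ix => [x _ _ ->|z p IHp x ix /= /andP[xz zp] yE]; first exact: connect0.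
have iz : connect (adjacent (coupler_edges L)) i z.
  exact: connect_trans ix (connect1 xz).
apply: connect_trans (IHp z iz zp yE); apply: connect1 => /=.
rewrite inE; apply/andP; split; first exact: xz.
by apply/fintype.subsetP => j; rewrite !inE => /orP[] /eqP ->.
Qed.

End Graphs.

(** * Connectivity by couplers and bounds by the Laplacian form *)

Section Synchrony.
Variables (R : realType) (n q : nat) (N : network R n q).
Local Notation A := (incidence N).
Local Notation G := (laplacian N).
Local Notation g := (conductance N).
Local Notation L := (network_linkage N).
Local Notation coupled := (adjacent (coupler_edges L)).

(** An unordered edge may be represented by [(i, j)] or by [(j, i)]; symmetry of the conductances
    reconciles the two. *)
Lemma coupledE i j : coupled i j = (i != j) && (0 < g i j).
Proof.
apply/imsetP/idP => [[[a b]]|]; last first.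
  by move=> ij; exists (i, j) => //; rewrite inE.
rewrite inE/= => /andP[ab gab] ijab.
have : a \in [set i; j]%SET by rewrite ijab set21.
have : b \in [set i; j]%SET by rewrite ijab set22.
rewrite !inE => /orP[] /eqP bE /orP[] /eqP aE; move: ab gab; rewrite aE bE.
- by rewrite eqxx.
- by move=> ji; rewrite (conductance_sym N ji) eq_sym ji.
- by move=> -> ->.
- by rewrite eqxx.
Qed.

(** Supplies the kernel vectors of [G]: indicators of sets that no coupler edge leaves. *)
Lemma laplacian_mul0 (x : 'cV[R]_n) :
  (forall i j, coupled i j -> x i 0 = x j 0) -> G *m x = 0.
Proof.
move=> xc; apply/matrixP => i j; rewrite !ord1 laplacian_mulE mxE.
apply: big1 => k ki; have [gik|] := ltP 0 (g i k).
  by rewrite (xc i k) ?subrr ?mulr0// coupledE eq_sym ki.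
have : 0 <= g i k by rewrite conductance_ge0// eq_sym.
by move=> ge0 le0; rewrite (le_anti (introT andP (conj le0 ge0))) mul0r.
Qed.

(** A discrete Poincare inequality, by induction along a path: each edge costs [2 / g], and
    [(u + v) ^+ 2 <= 2 * u ^+ 2 + 2 * v ^+ 2] joins it to the rest. *)
Lemma connect_sqr_le i j : connect coupled i j ->
  exists2 C, 0 <= C &
    forall x : 'cV[R]_n, (x i 0 - x j 0) ^+ 2 <= C * dot (G *m x) x.
Proof.
move=> /connectP[p]; elim: p i => [i _ ->|k p IHp i /= /andP[ik kp] jp].
  by exists 0 => // x; rewrite subrr expr0n mul0r.
have [C C0 Cx] := IHp k kp jp.
move: ik; rewrite coupledE => /andP[ik gik].
exists (2 * (2 / g i k + C)) => [|x].
  by rewrite mulr_ge0// addr_ge0// divr_ge0// ltW.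
have : (x i 0 - x k 0) ^+ 2 <= 2 / g i k * dot (G *m x) x.
  rewrite mulrAC ler_pdivlMr// mulrC edge_le_dot_laplacian//.
  by rewrite eq_sym.
move: (Cx x) (sqr_ge0 ((x i 0 - x k 0) - (x k 0 - x j 0))); nra.
Qed.

Lemma voltage_le_of_connect :
  (forall k, connect coupled (osc_pos N k) (osc_neg N k)) ->
  exists2 C, 0 <= C &
    forall x : 'cV[R]_n, dot (A^T *m x) (A^T *m x) <= C * dot (G *m x) x.
Proof.
move=> conn.
have [C C0 Cx] := fin_all_exists2 (fun k => connect_sqr_le (conn k)).
exists (\sum_k C k) => [|x]; first exact: sumr_ge0.
rewrite dotE mulr_suml; apply: ler_sum => k _.
by rewrite -expr2 voltageE.
Qed.

(** * Consequences of a bilayer partition *)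

Section Bilayer.
Variables V1 V2 : {set 'I_n}.
Hypothesis V12 : bilayer_partition L V1 V2.

Lemma bilayer_compl i : (i \in V2) = (i \notin V1).
Proof.
have [[disj UV _] _] := V12.
have : i \in V1 :|: V2 by rewrite UV inE.
rewrite inE; case: (boolP (i \in V1)) => //= i1 _.
exact: (disjointFr disj i1).
Qed.

Lemma bilayer_osc k : (osc_neg N k \in V1) = (osc_pos N k \notin V1).
Proof.
have [[_ _ bip] _] := V12.
have [|x [y [x1]]] := bip [set osc_pos N k; osc_neg N k]%SET.
  by apply/imsetP; exists k.
rewrite bilayer_compl => y1 xy.
have : x \in [set osc_pos N k; osc_neg N k]%SET by rewrite xy set21.
have : y \in [set osc_pos N k; osc_neg N k]%SET by rewrite xy set22.
rewrite !inE => /orP[] /eqP yE /orP[] /eqP xE; move: x1 y1; rewrite xE yE.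
- by move=> ->.
- by move=> -> ->.
- by move=> -> /negbTE ->.
- by move=> ->.
Qed.

Lemma bilayer_coupled i j : coupled i j -> (i \in V1) = (j \in V1).
Proof.
move=> ij; have [_ ncross] := V12.
case: (boolP (i \in V1)) (boolP (j \in V1)) => i1 [] j1 //.
  by have [] := ncross _ ij; exists i, j; rewrite bilayer_compl.
have [] := ncross _ ij; exists j, i; split => //; first by rewrite bilayer_compl.
by rewrite finset.setUC.
Qed.

Definition layer_indicator : 'cV[R]_n := \col_i (i \in V1)%:R.

Lemma laplacian_layer : G *m layer_indicator = 0.
Proof. by apply: laplacian_mul0 => i j /bilayer_coupled ij; rewrite !mxE ij. Qed.

Lemma voltage_layerE k :
  (A^T *m layer_indicator) k 0 = (-1) ^+ (osc_pos N k \notin V1).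
Proof.
rewrite voltageE !mxE bilayer_osc.
by case: (osc_pos N k \in V1); rewrite /= ?subr0 ?sub0r.
Qed.

(* With [s k = +- v k], the layers being connected bounds every [s k - s l];
   when the [s k] sum to [0], the sum of all [(s k - s l) ^+ 2] is [2 q |v|^2]. *)
Lemma voltage_le_of_layers :
  (0 < q)%N -> connected_graph V1 (layer_edges L V1) ->
  connected_graph V2 (layer_edges L V2) ->
  exists2 C, 0 <= C & forall x : 'cV[R]_n,
    dot (A^T *m layer_indicator) (A^T *m x) = 0 ->
    dot (A^T *m x) (A^T *m x) <= C * dot (G *m x) x.
Proof.
move=> q0 conn1 conn2.
(* Reorients every oscillator from [V1] to [V2], so that differences of voltages compare nodes
   within one layer. *)
pose top k := if osc_pos N k \in V1 then osc_pos N k else osc_neg N k.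
pose bot k := if osc_pos N k \in V1 then osc_neg N k else osc_pos N k.
have layer_connect (V : {set 'I_n}) i j : connected_graph V (layer_edges L V) ->
    i \in V -> j \in V -> connect coupled i j.
  move=> cV iV jV; apply: connect_sub (cV i j iV jV) => a b /=.
  by rewrite inE => /andP[ab _]; apply: connect1.
have top1 k : top k \in V1.
  by rewrite /top; case: ifP => // k1; rewrite bilayer_osc k1.
have bot2 k : bot k \in V2.
  by rewrite bilayer_compl /bot; case: ifP => k1; rewrite ?bilayer_osc k1.
have pairC (kl : 'I_q * 'I_q) : exists2 C, 0 <= C & forall x : 'cV[R]_n,
    ((x (top kl.1) 0 - x (bot kl.1) 0) - (x (top kl.2) 0 - x (bot kl.2) 0)) ^+ 2
    <= C * dot (G *m x) x.
  have [C C0 Cx] := connect_sqr_le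
    (layer_connect _ _ _ conn1 (top1 kl.1) (top1 kl.2)).
  have [D D0 Dx] := connect_sqr_le
    (layer_connect _ _ _ conn2 (bot2 kl.1) (bot2 kl.2)).
  exists (2 * (C + D)) => [|x]; first by rewrite mulr_ge0// addr_ge0.
  (* The left side is [(u - w) ^+ 2], with [u] the difference of the tops and [w] that of the
     bottoms; [0 <= (u + w) ^+ 2] bounds it by [2 * u ^+ 2 + 2 * w ^+ 2]. *)
  move: (Cx x) (Dx x) (sqr_ge0 ((x (top kl.1) 0 - x (top kl.2) 0)
    + (x (bot kl.1) 0 - x (bot kl.2) 0))); nra.
have [C C0 Cx] := fin_all_exists2 pairC.
exists (\sum_kl C kl) => [|x sum0]; first exact: sumr_ge0.
pose s k := x (top k) 0 - x (bot k) 0.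
have sE k : s k = (A^T *m layer_indicator) k 0 * (A^T *m x) k 0.
  rewrite voltage_layerE voltageE /s /top /bot.
  by case: ifP => _; rewrite ?mul1r ?mulN1r ?opprB.
have s0 : \sum_k s k = 0.
  by rewrite -[RHS]sum0 dotE; apply: eq_bigr => k _; rewrite sE.
have vE : dot (A^T *m x) (A^T *m x) = \sum_k s k ^+ 2.
  rewrite dotE; apply: eq_bigr => k _.
  by rewrite sE voltage_layerE exprMn sqrr_sign mul1r expr2.
have qE : \sum_k \sum_l (s k - s l) ^+ 2 = 2 * q%:R * \sum_k s k ^+ 2.
  transitivity (\sum_k (q%:R * s k ^+ 2 + \sum_l s l ^+ 2)).
    apply: eq_bigr => k _.
    rewrite (eq_bigr (fun l => s k ^+ 2 + s l ^+ 2 - 2 * s k * s l)).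
      rewrite sumrB -mulr_sumr s0 mulr0 subr0 big_split/= sumr_const card_ord.
      by rewrite mulr_natl.
    by move=> l _; ring.
  by rewrite big_split/= sumr_const card_ord -mulr_sumr -mulr_natl; ring.
have sC : \sum_k \sum_l (s k - s l) ^+ 2 <= (\sum_kl C kl) * dot (G *m x) x.
  rewrite pair_bigA/= mulr_suml; apply: ler_sum => kl _; exact: Cx.
(* The factor [2 * q] is at least [1] and is dropped. *)
rewrite vE; apply: le_trans sC; rewrite qE ler_peMl ?sumr_ge0//.
  by move=> k _; rewrite sqr_ge0.
by rewrite -natrM ler1n muln_gt0.
Qed.

End Bilayer.

(** * Cosine solutions and the two implications *)

Section Solutions.
Variables (omega0 : R) (omega0_gt0 : 0 < omega0).

(** Both terms of the equation vanish separately: the harmonic one because the second derivative is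
    [- omega0 ^+ 2] times the trajectory, the damping one because [x] lies in the kernel of [G]. *)
Lemma cos_solution (x : 'cV[R]_n) : G *m x = 0 ->
  is_solution N omega0 (fun t => cos (omega0 * t) *: x).
Proof.
move=> Gx.
have dlin (t : R) : is_derive t 1 (fun s => omega0 * s) omega0.
  by apply: (is_derive_eq (is_deriveZ omega0 (is_derive_id t 1)));
    rewrite /GRing.scale/= mulr1.
have dcos (t : R) := is_derive1_comp (is_derive_cos (omega0 * t)) (dlin t).
have dsin (t : R) := is_derive1_comp (is_derive_sin (omega0 * t)) (dlin t).
have dscale (f : R -> R) (t d : R) : is_derive t 1 f d ->
    is_derive t 1 (fun s => f s *: x) (d *: x).
  move=> fd; apply/is_derive_cVP => i.
  rewrite (_ : (fun s => _) = x i 0 \*: f).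
    by apply: is_derive_eq; rewrite mxE mulrC.
  by apply/funext => s; rewrite mxE mulrC.
have dx (t : R) := dscale _ _ _ (dcos t).
apply: (trajectory_solution
  (e2 := fun t => (- omega0 ^+ 2 * cos (omega0 * t)) *: x) dx) => t _.
split; first exact: dx.
  have d2 : is_derive t 1 (fun s => - sin (omega0 * s) * omega0)
      (- omega0 ^+ 2 * cos (omega0 * t)).
    rewrite (_ : (fun s => _) = - omega0 \*: (sin \o (fun s => omega0 * s))).
      by apply: (is_derive_eq (is_deriveZ (- omega0) (dsin t)));
        rewrite /GRing.scale/=; ring.
    by apply/funext => s /=; rewrite /GRing.scale/=; ring.
  exact: dscale d2.
rewrite scalerA -scalerDl mulNr addNr scale0r mulmx0 add0r.
by rewrite -scalemxAr Gx scaler0.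
Qed.

Lemma cos_voltage (x : 'cV[R]_n) t k :
  osc_voltage N (fun t => cos (omega0 * t) *: x) t k 0 =
  cos (omega0 * t) * (A^T *m x) k 0.
Proof. by rewrite /osc_voltage -scalemxAr mxE. Qed.

Lemma cos_voltage_vanish (x : 'cV[R]_n) k :
  osc_voltage N (fun t => cos (omega0 * t) *: x) t k 0 @[t --> +oo] --> (0 : R) ->
  (A^T *m x) k 0 = 0.
Proof.
apply: cvg0_frequently_eq => M; have [t Mt ct] := cos_frequently1 M omega0_gt0.
by exists t => //; rewrite cos_voltage ct mul1r.
Qed.

Lemma synchronous_kernel (x : 'cV[R]_n) k l : synchronous N omega0 ->
  G *m x = 0 -> `|(A^T *m x) k 0| = `|(A^T *m x) l 0|.
Proof.
move=> [sync _] /cos_solution xs; apply/eqP; rewrite -subr_eq0; apply/eqP.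
apply: cvg0_frequently_eq (sync _ xs k l) => M.
have [t Mt ct] := cos_frequently1 M omega0_gt0.
by exists t => //; rewrite !cos_voltage ct !mul1r.
Qed.

Lemma bilayer_of_synchronous :
  synchronous N omega0 -> bilayer_with_connected_layers L.
Proof.
move=> sync; have [_ [e se [k0 nvan]]] := sync.
have [k nconn] : exists k, ~~ connect coupled (osc_pos N k) (osc_neg N k).
  apply/existsP; rewrite -negb_forall; apply/negP => /forallP conn.
  have [C C0 Cx] := voltage_le_of_connect conn.
  apply: nvan; apply: (voltage_cvg0 omega0_gt0 C0 (solution_trajectory se)).
  by move=> t _; apply: Cx.
pose V i := [set j | connect coupled i j]%SET.
have VC i a b : connect coupled a b -> (a \in V i) = (b \in V i).
  by move=> ab; rewrite !inE; apply: same_connect_r ab i; apply: connect_adjacentC.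
(* The voltages of the indicator of [V i] are [0] or [+- 1], nonzero exactly on the oscillators that
   leave [V i]; synchrony equalizes their absolute values. *)
have cross i : (osc_pos N k \in V i) != (osc_neg N k \in V i) ->
    forall l, (osc_pos N l \in V i) != (osc_neg N l \in V i).
  move=> ki l; pose x : 'cV[R]_n := \col_j (j \in V i)%:R.
  have /(synchronous_kernel k l sync) : G *m x = 0.
    by apply: laplacian_mul0 => a b /connect1/(VC i) ab; rewrite !mxE ab.
  rewrite !voltageE !mxE; move: ki.
  case: (osc_pos N k \in _) (osc_neg N k \in _) => [] [] //= _;
    case: eqP => // ->; rewrite subrr normr0 => /eqP;
    by rewrite normr_eq0 ?subr0 ?sub0r ?oppr_eq0 oner_eq0.
pose V1 := V (osc_pos N k); pose V2 := V (osc_neg N k).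
have pos1 : osc_pos N k \in V1 by rewrite inE.
have neg1 : osc_neg N k \notin V1 by rewrite inE.
have neg2 : osc_neg N k \in V2 by rewrite inE.
have pos2 : osc_pos N k \notin V2 by rewrite inE connect_adjacentC.
have cross1 l : (osc_pos N l \in V1) != (osc_neg N l \in V1).
  by apply: cross; rewrite -/V1 pos1 (negbTE neg1).
have cross2 l : (osc_pos N l \in V2) != (osc_neg N l \in V2).
  by apply: cross; rewrite -/V2 neg2 (negbTE pos2).
have disj j : j \in V1 -> j \in V2 -> False.
  rewrite !inE => j1; rewrite connect_adjacentC => j2.
  by move: nconn; rewrite (connect_trans j1 j2).
(* Each [Vi] contains exactly one end of [l], and disjointness makes the two ends different. *)
have ends l : (osc_pos N l \in V1) && (osc_neg N l \in V2) ||
    (osc_neg N l \in V1) && (osc_pos N l \in V2).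
  move: (cross1 l) (cross2 l) (disj (osc_pos N l)) (disj (osc_neg N l)).
  case: (osc_pos N l \in V1); case: (osc_neg N l \in V1) => //= _;
  case: (osc_pos N l \in V2); case: (osc_neg N l \in V2) => //= _ dp dn;
  by [case: (dp isT isT)|case: (dn isT isT)].
exists V1, V2; split; [split| |]; [split| | |];
  try exact: component_layer_connected.
- rewrite disjoint_subset; apply/fintype.subsetP => j j1.
  by rewrite inE; apply/negP/disj.
- apply/setP => r; rewrite [RHS]inE finset.in_setU; have [l] := osc_cover N r.
  by case/orP: (ends l) => /andP[v1 v2]; rewrite in_set2 => /orP[] /eqP ->;
    rewrite ?v1 ?v2 ?orbT.
- move=> d /imsetP[l _ ->]; case/orP: (ends l) => /andP[v1 v2].
    by exists (osc_pos N l), (osc_neg N l).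
  by exists (osc_neg N l), (osc_pos N l); rewrite finset.setUC.
- move=> d dE [x [y [x1 y2 dxy]]]; apply: (disj y) => //.
  by rewrite -(VC _ x y)//; apply: connect1; rewrite /adjacent/= -dxy.
Qed.

Lemma synchronous_of_bilayer : (0 < q)%N ->
  bilayer_with_connected_layers L -> synchronous N omega0.
Proof.
move=> q0 [V1 [V2 [V12 conn1 conn2]]].
pose x := layer_indicator V1.
have Gx : G *m x = 0 := laplacian_layer V12.
have xk k : (A^T *m x) k 0 = (-1) ^+ (osc_pos N k \notin V1) := voltage_layerE V12 k.
split; last first.
  exists (fun t => cos (omega0 * t) *: x); first exact: cos_solution.
  exists (Ordinal q0) => /cos_voltage_vanish/eqP.
  by rewrite xk signr_eq0.
move=> e /solution_trajectory; move: (derive1 e) (derive1 (derive1 e)) => e1 e2 te.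
(* Removes the multiple of [x] that makes the remaining voltages orthogonal to those of [x]; the
   latter are [+- 1], hence of squared norm [q]. *)
pose J : 'M[R]_n := 1%:M - q%:R^-1 *: (x *m (A^T *m x)^T *m A^T).
have JE y : J *m y = y + (- (q%:R^-1 * dot (A^T *m x) (A^T *m y))) *: x.
  rewrite mulmxBl mul1mx -scalemxAl -!mulmxA [_^T *m _]mx11_scalar.
  by rewrite mul_mx_scalar scalerA scaleNr.
have xx : dot (A^T *m x) (A^T *m x) = q%:R.
  rewrite dotE (eq_bigr (fun _ => 1)) ?sumr_const ?card_ord// => k _.
  by rewrite xk -expr2 sqrr_sign.
have q0' : q%:R != 0 :> R by rewrite pnatr_eq0 -lt0n.
have Jorth y : dot (A^T *m x) (A^T *m (J *m y)) = 0.
  rewrite JE mulmxDr -scalemxAr dotC dotDl dotZl xx dotC; set d := dot _ _.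
  by field.
have tJ : trajectory N omega0
    (fun t => J *m e t) (fun t => J *m e1 t) (fun t => J *m e2 t).
  move=> t t0; have [de de1 eq] := te t t0.
  split; [exact: is_derive_mulmx|exact: is_derive_mulmx|].
  rewrite scalemxAr -mulmxDr [J *m e1 t]JE [G *m (_ + _)]mulmxDr.
  rewrite -[G *m (_ *: _)]scalemxAr Gx scaler0 addr0.
  (* Pairing the equation with [x] kills the damping term, as [G] is symmetric and [G *m x = 0]; so
     [J] leaves the harmonic term unchanged. *)
  rewrite JE (_ : dot _ _ = 0) ?mulr0 ?oppr0 ?scale0r ?addr0//.
  rewrite dotC -{1}[A]trmxK -dot_mulmxl trmxK mulmxA.
  move/eqP: eq; rewrite addr_eq0 => /eqP ->.
  by rewrite -scaleN1r dotZl dot_laplacianC Gx dot0l mulr0.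
have [C C0 Cx] := voltage_le_of_layers V12 q0 conn1 conn2.
have wcvg := voltage_cvg0 omega0_gt0 C0 tJ (fun t _ => Cx _ (Jorth (e1 t))).
(* The coefficient in [e t = J *m e t + z t *: x]. Every voltage of [z t *: x] has absolute value
   [|z t|], the common value to which all oscillators are compared. *)
pose z t := q%:R^-1 * dot (A^T *m x) (A^T *m e t).
have vz k t :
    `| `|osc_voltage N e t k 0| - `|z t| | <= `|(A^T *m (J *m e t)) k 0|.
  have -> : (A^T *m (J *m e t)) k 0 =
      osc_voltage N e t k 0 - z t * (-1) ^+ (osc_pos N k \notin V1).
    by rewrite JE mulmxDr -scalemxAr mxE [X in _ + X]mxE xk mulNr.
  rewrite (_ : `|z t| = `|z t * (-1) ^+ (osc_pos N k \notin V1)|).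
    exact: ler_dist_dist.
  by rewrite [RHS]normrM normr_sign mulr1.
move=> k l; apply/cvgr0Pnorm_lt => eps eps0; near=> t.
have wk : `|(A^T *m (J *m e t)) k 0| < eps / 2.
  by near: t; apply: (cvgr0_norm_lt _ (wcvg k)); rewrite divr_gt0.
have wl : `|(A^T *m (J *m e t)) l 0| < eps / 2.
  by near: t; apply: (cvgr0_norm_lt _ (wcvg l)); rewrite divr_gt0.
rewrite [eps]splitr (le_lt_trans _ (ltrD wk wl))//.
rewrite (le_trans _ (lerD (vz k t) (vz l t)))//.
rewrite [X in _ <= _ + X]distrC (le_trans _ (ler_normD _ _))//.
by rewrite addrA subrK.
Unshelve. all: by end_near. Qed.

End Solutions.
End Synchrony.

Theorem theorem1 (R : realType) (n q : nat) (N : network R n q) (omega0 : R)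
    (q_ge2 : (2 <= q)%N) (omega0_gt0 : 0 < omega0) :
  synchronous N omega0 <-> bilayer_with_connected_layers (network_linkage N).
Proof.
split; first exact: bilayer_of_synchronous.
exact/synchronous_of_bilayer/(ltnW q_ge2).
Qed.
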